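(* For each $k\ge 2$ and each even integer $L=2i\ge 2$, there is a splitting of $\mathbb{F}_k$ over a group of rank $r=(k-1)(L-2)+1$ relative to a cyclically reduced element $h$ containing all reduced words of length $L$ as subwords.
   Context: $\mathbb{F}_k$ is the free group of rank $k$, with elements viewed as reduced words on $X^{\pm1}$, where $X$ is a fixed free basis. A word $a_1\cdots a_q$ with $a_i\in X^{\pm1}$ is reduced if $a_{i+1}\neq a_i^{-1}$ for $1\le i\le q-1$, and cyclically reduced if in addition $a_q\ne a_1^{-1}$; its subwords are the words $a_i\cdots a_j$ with $1\le i\le j\le q$. A splitting of a group $G$ is an isomorphism of $G$ with the fundamental group of a graph of groups, equivalently an action of $G$ on a simplicial tree $T$ that is minimal (no proper invariant subtree), without inversion, and without redundant vertices (a vertex of valence 2 is the unique fixed point of some element of $G$); splittings are assumed non-trivial ($T$ is not a point). A splitting is over a subgroup $A$ if $A$ is an edge group, and relative to $h$ if $h$ fixes a point in $T$ (i.e. is contained in a conjugate of a vertex group). *)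

(* Defs.v *)
From HB Require Import structures.
From mathcomp Require Import all_boot all_fingroup.

Set Implicit Arguments.
Unset Strict Implicit.
Unset Printing Implicit Defensive.

Local Open Scope group_scope.

(* A letter (x, b) of X^{+-1} is x when b = true and x^-1 when b = false. *)
Definition letter_inv (X : Type) (a : X * bool) : X * bool := (a.1, ~~ a.2).

Definition reduced (X : eqType) (w : seq (X * bool)) : bool :=
  sorted (fun a b => b != letter_inv a) w.

Definition cyclically_reduced (X : eqType) (w : seq (X * bool)) : bool :=
  reduced w && (if w is a :: w' then last a w' != letter_inv a else true).

Record freegroup (X : choiceType) :=
  FreeGroup { word : seq (X * bool); word_reduced : reduced word }.

Section FreeGroup.

Variable X : choiceType.
Implicit Types (a b : X * bool) (u v w : seq (X * bool)) (f g h : freegroup X).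

HB.instance Definition _ := [isSub for @word X].
HB.instance Definition _ := [Choice of freegroup X by <:].

Lemma letter_invK : involutive (@letter_inv X).
Proof. by case=> x b; rewrite /letter_inv /= negbK. Qed.

(* Product of a letter and a reduced word, with cancellation. *)
Definition letter_mul a w : seq (X * bool) :=
  if w is b :: w' then if b == letter_inv a then w' else a :: w else [:: a].

Lemma letter_mul_reduced a w : reduced w -> reduced (letter_mul a w).
Proof.
case: w => [//|b w] /= bw; case: ifP => [_|ba]; first exact: path_sorted bw.
by rewrite /reduced /= ba.
Qed.

Lemma letter_mulK a w :
  reduced w -> letter_mul (letter_inv a) (letter_mul a w) = w.
Proof.
case: w => [|b w] /=; first by rewrite letter_invK eqxx.
case: eqP => [->|_] /=; last by rewrite letter_invK eqxx.
by case: w => [//|c w] /= /andP[/negPf->].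
Qed.

Lemma letter_mulVK a w :
  reduced w -> letter_mul a (letter_mul (letter_inv a) w) = w.
Proof. by move=> rw; rewrite -{1}[a]letter_invK letter_mulK. Qed.

Lemma foldr_reduced u w : reduced w -> reduced (foldr letter_mul w u).
Proof. by move=> rw; elim: u => //= a u; apply: letter_mul_reduced. Qed.

Lemma foldr_letter_mul w a v : reduced w ->
  foldr letter_mul w (letter_mul a v) = letter_mul a (foldr letter_mul w v).
Proof.
move=> rw; case: v => [//|b v] /=; case: eqP => [->|//].
by rewrite letter_mulVK ?foldr_reduced.
Qed.

Lemma foldr_letter_mulA w u v : reduced w ->
  foldr letter_mul w (foldr letter_mul v u)
  = foldr letter_mul (foldr letter_mul w v) u.
Proof. by move=> rw; elim: u => //= a u <-; rewrite foldr_letter_mul. Qed.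

Lemma foldr_letter_mul0 w : reduced w -> foldr letter_mul [::] w = w.
Proof.
elim: w => //= a w IHw aw; rewrite IHw; last exact: path_sorted aw.
by case: w aw {IHw} => //= b w /andP[/negPf->].
Qed.

Definition word_inv w : seq (X * bool) := rev (map (@letter_inv X) w).

Lemma word_invK : involutive word_inv.
Proof. by move=> w; rewrite /word_inv map_rev revK mapK //; apply: letter_invK. Qed.

Lemma word_inv_reduced w : reduced w -> reduced (word_inv w).
Proof.
rewrite /reduced /word_inv rev_sorted sorted_map.
apply: sub_sorted => a b /=; apply: contraNneq => ->.
by rewrite letter_invK.
Qed.

Lemma foldr_word_inv v w : reduced v ->
  foldr letter_mul (foldr letter_mul v w) (word_inv w) = v.
Proof.
move=> rv; elim: w => //= a w {2}<-.
by rewrite /word_inv /= rev_cons -cats1 foldr_cat /= letter_mulK ?foldr_reduced.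
Qed.

Definition fg_one : freegroup X := FreeGroup (isT : reduced [::]).
Definition fg_inv f : freegroup X :=
  FreeGroup (word_inv_reduced (word_reduced f)).
Definition fg_mul f g : freegroup X :=
  FreeGroup (foldr_reduced (word f) (word_reduced g)).

Lemma fg_mulA : associative fg_mul.
Proof.
by move=> f g h; apply: val_inj; rewrite /= foldr_letter_mulA ?word_reduced.
Qed.

Lemma fg_mul1 : left_id fg_one fg_mul.
Proof. by move=> f; apply: val_inj. Qed.

Lemma fg_mulg1 : right_id fg_one fg_mul.
Proof.
by move=> f; apply: val_inj; rewrite /= foldr_letter_mul0 ?word_reduced.
Qed.

Lemma fg_mulV : left_inverse fg_one fg_inv fg_mul.
Proof.
move=> f; apply: val_inj => /=.
rewrite -{1}(foldr_letter_mul0 (word_reduced f)).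
exact: (@foldr_word_inv [::]).
Qed.

Lemma fg_mulgV : right_inverse fg_one fg_inv fg_mul.
Proof.
move=> f; rewrite -{1}[f](_ : fg_inv (fg_inv f) = f) ?fg_mulV //.
by apply: val_inj; rewrite /= word_invK.
Qed.

HB.instance Definition _ :=
  isGroup.Build (freegroup X) fg_mulA fg_mul1 fg_mulg1 fg_mulV fg_mulgV.

End FreeGroup.

Definition free_of_rank (r : nat) (G : groupType) (A : G -> Prop) : Prop :=
  exists phi : {multiplicative freegroup 'I_r -> G},
    injective phi /\ (forall g, A g <-> exists w, g = phi w).

(* As a simplicial complex, a tree has neither loops nor multiple edges, so a
   symmetric irreflexive relation suffices.  A duplicate-free cyclic sequence of
   at most two vertices is a vertex or an edge run back and forth. *)
Record tree := Tree {
  vertex :> eqType;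
  adj : rel vertex;
  adj_sym : symmetric adj;
  adj_irr : irreflexive adj;
  tree_connected : forall x y, exists2 p, path adj x p & last x p = y;
  tree_acyclic : forall c, ucycle adj c -> size c <= 2
}.

Definition subtree (T : tree) (S : T -> Prop) : Prop :=
  (exists x, S x) /\
  (forall x y, S x -> S y -> exists p,
     [/\ path (@adj T) x p, last x p = y & forall z, z \in p -> S z]).

Definition valence2 (T : tree) (v : T) : Prop :=
  exists u w : T, u != w /\ adj v =i pred2 u w.

(* The conditions are on vertices only: when no inversion occurs, an element
   fixing a point interior to an edge fixes both endpoints of that edge. *)
Record splitting (G : groupType) := Splitting {
  stree :> tree;
  act : G -> stree -> stree;
  act1 : forall v, act 1 v = v;
  actM : forall g h v, act (g * h) v = act g (act h v);
  act_adj : forall g x y, adj (act g x) (act g y) = adj x y;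
  act_noinv : forall g x y, adj x y -> ~ (act g x = y /\ act g y = x);
  act_minimal : forall S : stree -> Prop,
    subtree S -> (forall g x, S x -> S (act g x)) -> forall x, S x;
  act_irredundant : forall v, valence2 v ->
    exists g, forall w, act g w = w <-> w = v;
  act_nontrivial : exists x y : stree, x != y
}.

Definition is_edge_group (G : groupType) (T : splitting G) (A : G -> Prop)
    : Prop :=
  exists x y : T, adj x y /\ (forall g, A g <-> act g x = x /\ act g y = y).

Definition relative_to (G : groupType) (T : splitting G) (h : G) : Prop :=
  exists v : T, act h v = v.

(* Main.v *)
From HB Require Import structures.
Require Import Defs.
From mathcomp Require Import all_boot all_algebra zify.

(** Let [a = x_0] and [b = x_1].  Map the free group onto [Z] by sending [a] and
[b] to [1] and the other generators to [0].  The kernel [N] is free on the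
letters [y_(m,j) = a^-j y_m a^j] ([j] an integer), where [y_0 = b a^-1] and the
other [y_m] are the remaining generators; [a] acts on [N] by shifting [j].  Put
[lo 0 = 0], [lo m = 1] for [m > 0], and let [V] be generated by the elements
[a^i y_m a^-i] with [lo m <= i < L].  Then the free group is an HNN extension of
[V] with stable letter [a]: the associated subgroups [V :&: a^-1 V a] and
[V :&: a V a^-1] are free factors of [V], and [a] maps one basis to the other.
The first one is generated by the [a^i y_m a^-i] with [lo m <= i < L - 1], so
its rank is [L - 1] (for [m = 0]) plus [L - 2] for each of the [k - 2] other
values of [m], that is, [(k - 1)(L - 2) + 1].

Topologically, [V] is the fundamental group, at [0], of the graph with vertices
[0, ..., L], with an edge labelled [a] and an edge labelled [b] from [i] to
[i + 1], and with a loop for each other generator at the interior vertices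
[1, ..., L - 1].  All letters can be read, in both directions, from an interior
vertex, so every reduced word of even length [L] can be read along a path
that is at the vertex [L / 2] halfway: both halves stay in the graph, since only
their last letter can take them out of the interior.  Such paths can be
joined into a single cyclically reduced loop at [0], whose label is [h].

The Bass-Serre tree is built by hand.  Its vertices are the right cosets of [V].
In the coordinates [Z] times [N] such a coset is a level [s] together with a
coset [V_s u] in [N], where [V_s] is generated by the letters [y_(m,j)] with [j]
in a window around [s]; a normal form is the reduced word [u] stripped of its
longest prefix in the letters of [V_s].  Two cosets are adjacent when their
levels differ by one and they meet in [N].  This graph is a tree because the
head letter of the normal form tells in which direction the root lies, which
defines a parent for each vertex ([strip_cmp]).  Vertices form a single orbit
([coset_act_trans]), whence minimality, and have at least three neighbours
([coset_not_valence2]).  The edge group is computed in [edge_group_free]; the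
element [h] comes from [reads_short] and [bracket_all]. *)

Set Implicit Arguments.
Unset Strict Implicit.
Unset Printing Implicit Defensive.

Local Open Scope group_scope.

(** * Homomorphisms from free groups *)

Section Universal.

Variables (X : choiceType) (G : groupType).
Implicit Types (f : X -> G) (a : X * bool) (u v w : seq (X * bool)).

Definition letter_eval f a : G := if a.2 then f a.1 else (f a.1)^-1.

Definition word_eval f w : G := foldr (fun a g => letter_eval f a * g) 1 w.

Lemma letter_eval_inv f a :
  letter_eval f (letter_inv a) = (letter_eval f a)^-1.
Proof. by case: a => x [] //=; rewrite /letter_eval /= invgK. Qed.

Lemma word_eval_cat f u v :
  word_eval f (u ++ v) = word_eval f u * word_eval f v.
Proof. by elim: u => [|a u IHu] /=; rewrite ?mul1g // IHu mulgA. Qed.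

Lemma word_eval_inv f w : word_eval f (word_inv w) = (word_eval f w)^-1.
Proof.
elim: w => [|a w IHw]; first by rewrite invg1.
rewrite /word_inv map_cons rev_cons -cats1 word_eval_cat -/(word_inv w) IHw /=.
by rewrite mulg1 letter_eval_inv invgM.
Qed.

Lemma word_eval_letter_mul f a w :
  word_eval f (letter_mul a w) = letter_eval f a * word_eval f w.
Proof.
case: w => [//|b w] /=; case: eqP => [->|_] //.
by rewrite letter_eval_inv mulVKg.
Qed.

Definition fg_hom f (g : freegroup X) : G := word_eval f (word g).

Lemma fg_homM f : {morph fg_hom f : g h / g * h}.
Proof.
move=> g h; rewrite /fg_hom /=; elim: (word g) => [|a u IHu] /=.
  by rewrite mul1g.
by rewrite word_eval_letter_mul IHu mulgA.
Qed.

HB.instance Definition _ f :=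
  isUMagmaMorphism.Build (freegroup X) G (fg_hom f) (erefl, fg_homM f).

End Universal.

Definition fg_gen (X : choiceType) (x : X) : freegroup X :=
  FreeGroup (isT : reduced [:: (x, true)]).

Lemma fg_hom_gen (X : choiceType) (G : groupType) (f : X -> G) x :
  fg_hom f (fg_gen x) = f x.
Proof. exact: mulg1. Qed.

Lemma word_letter_eval (X : choiceType) (a : X * bool) :
  word (letter_eval (@fg_gen X) a) = [:: a].
Proof. by case: a => x []. Qed.

Lemma word_word_eval (X : choiceType) (w : seq (X * bool)) :
  reduced w -> word (word_eval (@fg_gen X) w) = w.
Proof.
elim: w => //= a w IHw aw; rewrite word_letter_eval /= IHw; last first.
  exact: path_sorted aw.
by case: w aw {IHw} => //= b w /andP[/negPf->].
Qed.

Lemma freegroupE (X : choiceType) (g : freegroup X) :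
  g = word_eval (@fg_gen X) (word g).
Proof. by apply: val_inj; rewrite /= word_word_eval ?word_reduced. Qed.

Lemma freegroup_ext (X : choiceType) (G : groupType)
    (p q : UMagmaMorphism.type (freegroup X) G) :
  (forall x, p (fg_gen x) = q (fg_gen x)) -> p =1 q.
Proof.
move=> pq g; rewrite (freegroupE g); elim: (word g) => [|[x b] w IHw] /=.
  by rewrite !gmulf1.
by rewrite !gmulfM IHw; case: b; rewrite /letter_eval /= ?gmulfV pq.
Qed.

Section Map.

Variables (X Y : choiceType) (e : X -> Y).
Hypothesis e_inj : injective e.

Definition letter_map (a : X * bool) : Y * bool := (e a.1, a.2).

Lemma letter_map_inj : injective letter_map.
Proof. by move=> [x b] [y c] [/e_inj-> ->]. Qed.

Lemma letter_map_inv a : letter_map (letter_inv a) = letter_inv (letter_map a).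
Proof. by []. Qed.

Lemma map_reduced w : reduced (map letter_map w) = reduced w.
Proof.
rewrite /reduced sorted_map; apply: eq_sorted => a b /=.
by rewrite -letter_map_inv (inj_eq letter_map_inj).
Qed.

Definition fg_map (g : freegroup X) : freegroup Y :=
  FreeGroup (etrans (map_reduced (word g)) (word_reduced g)).

Lemma fg_map_inj : injective fg_map.
Proof.
by move=> g h /(congr1 (@word Y)) /= /(inj_map letter_map_inj) /val_inj.
Qed.

Lemma fg_mapE g : fg_map g = fg_hom (fun x => fg_gen (e x)) g.
Proof.
apply: val_inj; rewrite /= -[LHS](@word_word_eval Y); last first.
  by rewrite map_reduced word_reduced.
rewrite /fg_hom; congr word; elim: (word g) => //= a w ->.
by case: a => x [].
Qed.

Lemma fg_mapM : {morph fg_map : g h / g * h}.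
Proof. by move=> g h; rewrite !fg_mapE gmulfM. Qed.

HB.instance Definition _ :=
  isUMagmaMorphism.Build (freegroup X) (freegroup Y) fg_map
    (val_inj (erefl : word (fg_map 1) = word 1), fg_mapM).

(** Injectivity on letters makes the image of a reduced word reduced without any
cancellation, so subgroups generated by subsets of the basis can be recognized
on reduced words. *)
Lemma fg_map_onto (g : freegroup Y) :
  (forall a, a \in word g -> exists x, a.1 = e x) -> exists h, g = fg_map h.
Proof.
move=> sub; suff [w gw]: exists w, word g = map letter_map w.
  have rw: reduced w by rewrite -map_reduced -gw word_reduced.
  by exists (FreeGroup rw); apply: val_inj.
elim: (word g) sub => [|[y b] v IHv] sub; first by exists [::].
have [|w ->] := IHv; first by move=> a va; apply: sub; rewrite inE va orbT.
have [x /= ->] := sub (y, b) (mem_head _ _).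
by exists ((x, b) :: w).
Qed.

End Map.

(** * Integer powers *)

Definition zexpg (G : groupType) (x : G) (n : int) : G :=
  match n with Posz m => x ^+ m | Negz m => x ^- m.+1 end.

Lemma zexpgD (G : groupType) (x : G) m n :
  zexpg x (m + n)%R = zexpg x m * zexpg x n.
Proof.
have S1 i : zexpg x (i + 1)%R = zexpg x i * x.
  case: i => [i|[|i]] /=; first by rewrite addn1 expgSr.
    by rewrite mulVg.
  by rewrite subn1 [in RHS]expgS invgM mulgVK.
elim/int_rec: n => [|n IHn|n IHn]; first by rewrite GRing.addr0 mulg1.
  by rewrite -addn1 PoszD GRing.addrA !S1 IHn mulgA.
apply: (@mulIg _ x); rewrite -S1 -mulgA -S1.
by rewrite (_ : (_ + _ + 1) = m - n%:Z)%R ?IHn; [congr (_ * zexpg x _) |]; lia.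
Qed.

Lemma gmulf_zexpg (G H : groupType) (f : UMagmaMorphism.type G H) x n :
  f (zexpg x n) = zexpg (f x) n.
Proof. by case: n => n /=; rewrite ?gmulfV gmulfXn. Qed.

(** * Trees defined by a parent function *)

Section RootedTree.

Variables (V : eqType) (root : V) (parent : V -> V) (depth : V -> nat).
Hypothesis parent_root : parent root = root.
Hypothesis depth_parent : forall x, x != root -> depth (parent x) < depth x.

Definition parent_adj : rel V :=
  fun x y => (x != y) && ((parent x == y) || (parent y == x)).

Lemma parent_adj_sym : symmetric parent_adj.
Proof. by move=> x y; rewrite /parent_adj eq_sym orbC. Qed.

Lemma parent_adj_irr : irreflexive parent_adj.
Proof. by move=> x; rewrite /parent_adj eqxx. Qed.

Lemma adj_parent x : x != root -> parent_adj x (parent x).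
Proof.
move=> x_r; rewrite /parent_adj eqxx andbT.
by apply: contraTneq (depth_parent x_r) => <-; rewrite ltnn.
Qed.

(** Of two neighbours the deeper one is the child; hence a vertex has at most
one neighbour that is not strictly deeper.  [depth] can be any measure that
decreases strictly towards the root, not only the distance to it. *)
Lemma parent_adj_depth x y :
  parent_adj x y -> depth y <= depth x -> parent x = y.
Proof.
case/andP=> xy /orP[/eqP//|/eqP yx]; rewrite leqNgt -yx depth_parent //.
by apply: contraNneq xy => yr; rewrite -yx yr parent_root.
Qed.

Lemma parent_connected x y : exists2 p, path parent_adj x p & last x p = y.
Proof.
have up z: exists2 p, path parent_adj z p & last z p = root.
  have [n] := ubnP (depth z); elim: n z => // n IHn z zn.
  have [->|z_r] := eqVneq z root; first by exists [::].
  have [|p zp lp] := IHn (parent z).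
    exact: leq_trans (depth_parent z_r) zn.
  by exists (parent z :: p) => //=; rewrite adj_parent.
have [p xp lp] := up x; have [q yq lq] := up y.
exists (p ++ rev (belast y q)).
  rewrite cat_path xp lp -lq rev_path.
  by rewrite (eq_path (e' := parent_adj)) // => a b; rewrite parent_adj_sym.
rewrite last_cat lp; case: q lq {yq} => [/= -> //|z q] _ /=.
by rewrite rev_cons last_rcons.
Qed.

(** Both neighbours, on a cycle, of a vertex of maximal depth are its parent,
so they coincide. *)
Lemma parent_acyclic c : ucycle parent_adj c -> size c <= 2.
Proof.
case: c => [//|z c'] cyc; set c := z :: c' in cyc *.
have [x cx xmax]: exists2 x, x \in c & forall y, y \in c -> depth y <= depth x.
  elim: (c) (isT : c != [::]) => // a s IHs _.
  have [->|s0] := eqVneq s [::].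
    by exists a => [|y]; rewrite inE ?eqxx // => /eqP->.
  have [x xs xm] := IHs s0.
  have [ax|/ltnW xa] := leqP (depth a) (depth x).
    exists x => [|y]; first by rewrite inE xs orbT.
    by rewrite inE => /predU1P[->|/xm].
  exists a => [|y]; first by rewrite mem_head.
  by rewrite inE => /predU1P[->|/xm yx]//; apply: leq_trans yx xa.
have [i s cis] := rot_to cx.
have: ucycle parent_adj (x :: s) by rewrite -cis rot_ucycle.
have {}xmax y: y \in x :: s -> depth y <= depth x.
  by rewrite -cis mem_rot; apply: xmax.
have ->: size c = (size s).+1 by rewrite -(size_rot i) cis.
case: s {cis} xmax => [//|y s] xmax /andP[/= /andP[xy]].
rewrite rcons_path => /andP[_ lx] /and3P[_ ys _].
have px: parent x = y.
  by apply: parent_adj_depth xy _; apply: xmax; rewrite !inE eqxx orbT.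
have: parent x = last y s.
  apply: parent_adj_depth; first by rewrite parent_adj_sym.
  by apply: xmax; rewrite inE mem_last orbT.
case: s ys {xmax lx} => [//|t s] /=; rewrite px => + yl.
by rewrite {1}yl mem_last.
Qed.

Definition rooted_tree : tree :=
  Tree parent_adj_sym parent_adj_irr parent_connected parent_acyclic.

End RootedTree.

(** * The free group as a semidirect product *)

Section Semidirect.

Variable M : choiceType.

Definition shift (s : int) (y : M * int) : M * int := (y.1, (y.2 + s)%R).

Lemma shift_inj s : injective (shift s).
Proof. by move=> [m i] [l j] [-> /GRing.addIr->]. Qed.

Definition fg_shift s := fg_map (@shift_inj s).

HB.instance Definition _ s := UMagmaMorphism.on (fg_shift s).

Lemma fg_shiftD s t u : fg_shift t (fg_shift s u) = fg_shift (s + t)%R u.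
Proof.
apply: val_inj; rewrite /= -map_comp; apply: eq_map => -[[m i] b].
by rewrite /letter_map /shift /= GRing.addrA.
Qed.

Lemma fg_shift0 u : fg_shift 0%R u = u.
Proof.
apply: val_inj; rewrite /= -[RHS]map_id; apply: eq_map => -[[m i] b].
by rewrite /letter_map /shift /= GRing.addr0.
Qed.

(** The semidirect product of [Z], generated by [a], and of the free group on
the letters [y_(m,j)], in which conjugation by [a] adds [1] to [j].  The pair
[(s, u)] stands for [a^s u], so that [(a^s u) (a^t v) = a^(s+t) u^(a^t) v]. *)
Definition shiftprod : Type := (int * freegroup (M * int)%type)%type.

HB.instance Definition _ := Choice.on shiftprod.

Implicit Types p q r : shiftprod.

Definition sd_mul p q : shiftprod := ((p.1 + q.1)%R, fg_shift q.1 p.2 * q.2).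
Definition sd_one : shiftprod := (0%R, 1).
Definition sd_inv p : shiftprod := ((- p.1)%R, fg_shift (- p.1)%R p.2^-1).

Lemma sd_mulA : associative sd_mul.
Proof.
move=> p q r; rewrite /sd_mul /= GRing.addrA; congr pair.
by rewrite gmulfM /= fg_shiftD mulgA.
Qed.

Lemma sd_mul1g : left_id sd_one sd_mul.
Proof. by case=> s u; rewrite /sd_mul /= GRing.add0r gmulf1 mul1g. Qed.

Lemma sd_mulg1 : right_id sd_one sd_mul.
Proof. by case=> s u; rewrite /sd_mul /= GRing.addr0 fg_shift0 mulg1. Qed.

Lemma sd_mulVg : left_inverse sd_one sd_inv sd_mul.
Proof.
case=> s u; rewrite /sd_mul /= fg_shiftD GRing.addNr; congr pair.
by rewrite fg_shift0 mulVg.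
Qed.

Lemma sd_mulgV : right_inverse sd_one sd_inv sd_mul.
Proof.
case=> s u; rewrite /sd_mul /= GRing.addrN; congr pair.
by rewrite -gmulfM mulgV gmulf1.
Qed.

HB.instance Definition _ :=
  isGroup.Build shiftprod sd_mulA sd_mul1g sd_mulg1 sd_mulVg sd_mulgV.

Lemma sd_mulE p q : p * q = ((p.1 + q.1)%R, fg_shift q.1 p.2 * q.2).
Proof. by []. Qed.

Lemma sd_invE p : p^-1 = ((- p.1)%R, fg_shift (- p.1)%R p.2^-1).
Proof. by []. Qed.

Definition sd_base (u : freegroup (M * int)%type) : shiftprod := (0%R, u).

Lemma sd_baseM : {morph sd_base : u v / u * v}.
Proof. by move=> u v; rewrite sd_mulE /= fg_shift0. Qed.

HB.instance Definition _ :=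
  isUMagmaMorphism.Build (freegroup (M * int)%type) shiftprod sd_base
    (erefl, sd_baseM).

Lemma zexpg_sd s : zexpg ((1%R, 1) : shiftprod) s = (s, 1).
Proof.
have pos i : ((1%R, 1) : shiftprod) ^+ i = (Posz i, 1).
  elim: i => // i IHi.
  by rewrite expgSr IHi sd_mulE /= gmulf1 mulg1 -addn1 PoszD.
by case: s => i; rewrite /= pos // sd_invE /= invg1 gmulf1.
Qed.

End Semidirect.

Section Coordinates.

Variable n : nat.

Let M := 'I_n.+1.
Let F := freegroup 'I_n.+2.

Definition stable : F := fg_gen ord0.

(** The generator [b = y_0 a] is [a (a^-1 y_0 a) = a y_(0,1)], which accounts
for the index [1]. *)
Definition sd_gen (x : 'I_n.+2) : shiftprod M :=
  if unlift ord0 x is Some m then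
    if m == ord0 then (1%R, fg_gen (m, 1%R)) else (0%R, fg_gen (m, 0%R))
  else (1%R, 1).

Definition to_sd : F -> shiftprod M := fg_hom sd_gen.

HB.instance Definition _ := UMagmaMorphism.on to_sd.

(** The elements [y_m]: [b a^-1] for [m = 0], and a generator otherwise. *)
Definition kernel_gen (m : M) : F :=
  if m == ord0 then fg_gen (lift ord0 m) * stable^-1 else fg_gen (lift ord0 m).

Definition kernel_hom : freegroup (M * int)%type -> F :=
  fg_hom (fun y => kernel_gen y.1 ^ zexpg stable y.2).

HB.instance Definition _ := UMagmaMorphism.on kernel_hom.

Lemma kernel_hom_shift s u :
  kernel_hom (fg_shift s u) = kernel_hom u ^ zexpg stable s.
Proof.
rewrite /kernel_hom /fg_hom /=; elim: (word u) => [|[[m i] b] w IHw] /=.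
  by rewrite conj1g.
rewrite IHw conjMg; congr (_ * _).
by case: b; rewrite /letter_eval /= zexpgD conjgM ?conjVg.
Qed.

Definition of_sd (p : shiftprod M) : F := zexpg stable p.1 * kernel_hom p.2.

Lemma of_sdM : {morph of_sd : p q / p * q}.
Proof.
move=> p q; rewrite /of_sd sd_mulE /= gmulfM /= kernel_hom_shift zexpgD conjgE.
by rewrite !mulgA mulgK.
Qed.

HB.instance Definition _ :=
  isUMagmaMorphism.Build (shiftprod M) F of_sd (mulg1 1 : of_sd 1 = 1, of_sdM).

Lemma to_sdK : cancel to_sd of_sd.
Proof.
move=> g; apply: (freegroup_ext (p := of_sd \o to_sd) (q := idfun)) => x /=.
rewrite /to_sd fg_hom_gen /sd_gen /of_sd.
case: unliftP => [m ->|->] /=; last by rewrite gmulf1 mulg1.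
have [->|m0] := eqVneq m ord0; rewrite /= /kernel_hom fg_hom_gen /kernel_gen.
  by rewrite /= conjgE mulgA mulgV mul1g mulgVK.
by rewrite (negPf m0) mul1g conjg1.
Qed.

Lemma to_sd_stable s : to_sd (zexpg stable s) = (s, 1).
Proof.
by rewrite gmulf_zexpg /= /to_sd fg_hom_gen /sd_gen unlift_none zexpg_sd.
Qed.

(** In particular [kernel_hom] is injective: the elements [a^-j y_m a^j] form a
basis of the subgroup they generate. *)
Lemma to_sd_kernel u : to_sd (kernel_hom u) = (0%R, u).
Proof.
apply: (freegroup_ext (p := to_sd \o kernel_hom) (q := @sd_base M)).
move=> [m j] /=.
rewrite /kernel_hom fg_hom_gen conjgE !gmulfM gmulfV /= !to_sd_stable /=.
have ->: to_sd (kernel_gen m) = (0%R, fg_gen (m, 0%R)).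
  rewrite /kernel_gen; case: eqP => [->|/eqP m0].
    rewrite gmulfM gmulfV /= -[stable]/(zexpg stable 1) to_sd_stable.
    rewrite /to_sd fg_hom_gen /sd_gen liftK eqxx sd_mulE sd_invE /=.
    rewrite invg1 gmulf1 mulg1; congr pair; exact: val_inj.
  by rewrite /to_sd fg_hom_gen /sd_gen liftK (negPf m0).
rewrite !sd_mulE sd_invE /=; congr pair; first by lia.
rewrite invg1 !gmulf1 mul1g mulg1; apply: val_inj.
by rewrite /= /letter_map /shift /= GRing.add0r.
Qed.

Lemma of_sdK : cancel of_sd to_sd.
Proof.
move=> [s u]; rewrite /of_sd gmulfM /= to_sd_stable to_sd_kernel sd_mulE /=.
by rewrite GRing.addr0 gmulf1 mul1g.
Qed.

End Coordinates.

(** * The tree of cosets *)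

Section CosetTree.

Variables (n L : nat).

Let M := 'I_n.+1.
Let F := freegroup 'I_n.+2.
Let Y : choiceType := (M * int)%type.

Implicit Types (s t : int) (w : seq (Y * bool)) (p q : shiftprod M).

(** The letters [y_(m,j)] with [window s (m,j)] generate [V_s = a^-s V a^s].  For
[m > 0] the window is one shorter, at its upper end. *)
Definition window s (y : Y) : bool :=
  ((s - L%:R < y.2) && (y.2 + (y.1 != ord0)%:R <= s))%R.

Lemma window_shift s t y : window (s + t)%R (shift t y) = window s y.
Proof. by rewrite /window /=; case: (y.1 != ord0) => /=; lia. Qed.

(** Normal form of the right coset of a word modulo [V_s]: reduced words in the
window form a free factor, so a coset has one representative whose head lies
outside of the window. *)
Fixpoint strip s w :=
  if w is a :: w' then if window s a.1 then strip s w' else w else [::].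

Lemma strip_reduced s w : reduced w -> reduced (strip s w).
Proof.
elim: w => //= a w IHw aw; case: ifP => // _.
exact/IHw/path_sorted/aw.
Qed.

Lemma strip_id s w : strip s (strip s w) = strip s w.
Proof. by elim: w => //= a w IHw; case: ifP => //= ->. Qed.

Lemma strip_nil s w : strip s w = [::] <-> all (fun a => window s a.1) w.
Proof. by elim: w => //= a w IHw; case: ifP. Qed.

Lemma size_strip s w : size (strip s w) <= size w.
Proof. by elim: w => //= a w; case: ifP => // _ /leqW. Qed.

Lemma strip_head s a w : strip s (a :: w) = a :: w -> window s a.1 = false.
Proof.
move=> /=; case: ifP => // _ sw.
by have := size_strip s w; rewrite sw ltnn.
Qed.

Lemma strip_shift s t w :
  strip (s + t)%R (map (letter_map (shift t)) w)
  = map (letter_map (shift t)) (strip s w).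
Proof. by elim: w => //= a w IHw; rewrite window_shift; case: ifP. Qed.

Lemma strip_letter_mul s a w :
  window s a.1 -> strip s (letter_mul a w) = strip s w.
Proof.
move=> sa; case: w => [|b w] /=; first by rewrite sa.
by case: eqP => [->|_] /=; rewrite sa.
Qed.

(** The letters that [strip] removes from the left factor lie in [V_s], and
multiplying by them on the left does not change the coset of the product. *)
Lemma strip_foldr s v w :
  strip s (foldr (@letter_mul _) w v)
  = strip s (foldr (@letter_mul _) w (strip s v)).
Proof.
elim: v => //= a v IHv; case: ifP => [sa|//].
by rewrite strip_letter_mul.
Qed.

Definition fg_strip s (u : freegroup Y) :=
  FreeGroup (strip_reduced s (word_reduced u)).

(** Since [a^s V_s = V a^s], the coset [V a^s u] is [a^s] times the coset of [u]
modulo [V_s]. *)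
Definition coset_rep p : shiftprod M := (p.1, fg_strip p.1 p.2).

Lemma coset_rep_id p : coset_rep (coset_rep p) == coset_rep p.
Proof. by apply/eqP; congr pair; apply: val_inj; rewrite /= strip_id. Qed.

Lemma coset_repM p q : coset_rep (coset_rep p * q) = coset_rep (p * q).
Proof.
congr pair; apply: val_inj; rewrite /= [in RHS]strip_foldr strip_foldr.
by congr (strip _ (foldr _ _ _)); rewrite !strip_shift strip_id.
Qed.

Definition coset_vertex := {p : shiftprod M | coset_rep p == p}.

Definition to_vertex p : coset_vertex :=
  exist (fun q => is_true (coset_rep q == q)) (coset_rep p) (coset_rep_id p).

Implicit Types x y : coset_vertex.

Lemma to_vertexK x : to_vertex (val x) = x.
Proof. by apply: val_inj; apply: eqP (valP x). Qed.

Lemma strip_vertex x : strip (val x).1 (word (val x).2) = word (val x).2.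
Proof. by have /eqP/(congr1 (fun p => word p.2)) := valP x. Qed.

(** The level towards which the root lies, seen from a coset with normal form
[w].  For a head letter [y_(m,j)] outside of the window of level [s], either
[j <= s - L], and then [j + 1 < s] because [L >= 2], or [j > s - lo m], and then
[j + 1 > s]: the level [j + 1] has [y_(m,j)] in its window, and differs from
[s].  The root is the coset of the empty word at level [0]. *)
Definition aim w : int := if w is a :: _ then (a.1.2 + 1)%R else 0%R.

Definition coset_root : coset_vertex := to_vertex 1.

Definition coset_parent x : coset_vertex :=
  let: (s, u) := val x in
  if (aim (word u) < s)%R then to_vertex ((s - 1)%R, u) else
  if (s < aim (word u))%R then to_vertex ((s + 1)%R, u) else x.

(** Moving one level towards the aim decreases the distance to it; when this
makes the head letters disappear, the aim changes, and the triangle inequality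
bounds the distance to the new aim by the variation of the aim along the
letters that disappeared. *)
Fixpoint word_var w : nat :=
  if w is a :: w' then absz (aim w - aim w')%R + word_var w' else 0.

Definition coset_depth x : nat :=
  absz ((val x).1 - aim (word (val x).2))%R + word_var (word (val x).2).

Lemma word_var_strip s t w :
  absz (t - aim (strip s w))%R + word_var (strip s w)
  <= absz (t - aim w)%R + word_var w.
Proof.
elim: w => //= a w IHw; case: ifP => _ //.
by apply: leq_trans IHw _; rewrite addnA leq_add2r; lia.
Qed.

Lemma coset_parent_root : coset_parent coset_root = coset_root.
Proof. by []. Qed.

Hypothesis L_ge2 : 2 <= L.

Lemma aim_eq_level x : aim (word (val x).2) = (val x).1 -> x = coset_root.
Proof.
move=> lx; apply: val_inj; move: (strip_vertex x) lx.
case: (val x) => s u /=; case uw: (word u) => [|[[m i] b] w] /=.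
  by move=> _ <-; congr pair; apply: val_inj.
move=> /strip_head; rewrite /window /= => + s_i; rewrite -s_i.
by case: (m != ord0) => /=; lia.
Qed.

Lemma coset_depth_parent x :
  x != coset_root -> coset_depth (coset_parent x) < coset_depth x.
Proof.
move=> x_r; have: aim (word (val x).2) != (val x).1.
  by apply: contraNneq x_r => /aim_eq_level->.
rewrite /coset_depth /coset_parent; case: (val x) => s u /= su.
case: ifP => [us|]; last case: ifP => [us _|]; last by lia.
  apply: leq_ltn_trans (word_var_strip (s - 1)%R (s - 1)%R (word u)) _.
  by rewrite ltn_add2r; move: us; move: (aim _) => t us; lia.
apply: leq_ltn_trans (word_var_strip (s + 1)%R (s + 1)%R (word u)) _.
by rewrite ltn_add2r; move: us; move: (aim _) => t us; lia.
Qed.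

Definition coset_tree : tree :=
  rooted_tree coset_parent_root coset_depth_parent.

(** The cosets of [w] at levels [s] and [s + 1] are parent and child: this is
where the shape of the windows matters.  If the head of [w] belongs to both
windows it can be removed from [w].  Otherwise it is the head of one or
both of the normal forms, and for one of them its aim points to the other level. *)
Lemma strip_cmp s w :
  let u := strip s w in let u' := strip (s + 1)%R w in
  (s < aim u)%R /\ strip (s + 1)%R u = u'
  \/ (aim u' < s + 1)%R /\ strip s u' = u.
Proof.
elim: w => [|[[m i] b] w IHw] /=.
  by case: (boolP (s < 0)%R) => s0; [left|right]; split=> //; lia.
case: ifP => sa; case: ifP => s1a //=; rewrite ?sa ?s1a.
- right; split=> //; move: sa s1a; rewrite /window.
  by case: (_ != ord0) => /=; lia.
- left; split=> //; move: sa s1a; rewrite /window.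
  by case: (_ != ord0) => /=; lia.
(* The letter is the head of both normal forms, with the same aim. *)
have [sa1|sa1] := boolP (s < i + 1)%R; [by left | right; split=> //].
by lia.
Qed.

Lemma adj_level s u :
  @adj coset_tree (to_vertex (s, u)) (to_vertex ((s + 1)%R, u)).
Proof.
rewrite /= /parent_adj; apply/andP; split.
  by apply/eqP=> /(congr1 (fun x => (val x).1)) /=; lia.
rewrite /coset_parent /=.
have [[su eu]|[su eu]] := strip_cmp s (word u).
  apply/orP; left; rewrite ifF; last by move: su; move: (aim _) => t; lia.
  by rewrite su; apply/eqP/val_inj; congr pair; apply: val_inj.
rewrite su; apply/orP; right; apply/eqP/val_inj => /=.
rewrite /coset_rep /= GRing.addrK; congr pair.
by apply: val_inj; rewrite /= eu.
Qed.

(** With [adj_level], this describes adjacency as the meeting of cosets at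
consecutive levels, which, unlike the parent, is invariant under translation. *)
Lemma adj_levelP x y : @adj coset_tree x y -> exists s u,
  (x = to_vertex (s, u) /\ y = to_vertex ((s + 1)%R, u))
  \/ (y = to_vertex (s, u) /\ x = to_vertex ((s + 1)%R, u)).
Proof.
have par z : z != coset_parent z -> exists s u,
    (z = to_vertex (s, u) /\ coset_parent z = to_vertex ((s + 1)%R, u))
    \/ (coset_parent z = to_vertex (s, u) /\ z = to_vertex ((s + 1)%R, u)).
  rewrite /coset_parent; case: (val z) (to_vertexK z) => s u ez.
  case: ifP => _; last case: ifP => _; last by rewrite eqxx.
    by exists (s - 1)%R, u; right; rewrite GRing.subrK ez.
  by exists s, u; left; rewrite ez.
case/andP=> xy /orP[] /eqP pxy; first by rewrite -pxy in xy *; apply: par.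
rewrite -pxy eq_sym in xy *; have [s [u [h|h]]] := par _ xy; exists s, u; tauto.
Qed.

(** Right cosets carry a right action, hence the inverse. *)
Definition coset_act (g : F) (x : coset_tree) : coset_tree :=
  to_vertex (val x * (to_sd g)^-1).

Lemma coset_act_to_vertex g p :
  coset_act g (to_vertex p) = to_vertex (p * (to_sd g)^-1).
Proof. by apply: val_inj; rewrite /= coset_repM. Qed.

Lemma coset_act1 x : coset_act 1 x = x.
Proof. by rewrite /coset_act gmulf1 invg1 mulg1 to_vertexK. Qed.

Lemma coset_actM g h x : coset_act (g * h) x = coset_act g (coset_act h x).
Proof. by rewrite -(to_vertexK x) !coset_act_to_vertex gmulfM invgM mulgA. Qed.

Lemma coset_act_adj g x y :
  @adj coset_tree (coset_act g x) (coset_act g y) = @adj coset_tree x y.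
Proof.
have sub h z z' : @adj coset_tree z z' ->
    @adj coset_tree (coset_act h z) (coset_act h z').
  have dir s u : @adj coset_tree (coset_act h (to_vertex (s, u)))
      (coset_act h (to_vertex ((s + 1)%R, u))).
    rewrite !coset_act_to_vertex; move: ((to_sd h)^-1) => p.
    rewrite !sd_mulE /=.
    by rewrite GRing.addrAC; apply: adj_level.
  case/adj_levelP=> s [u [] [-> ->]]; first exact: dir.
  by rewrite adj_sym dir.
apply/idP/idP => [|/sub//]; move/(sub g^-1).
by rewrite -!coset_actM mulVg !coset_act1.
Qed.

Lemma coset_act_noinv g x y :
  @adj coset_tree x y -> ~ (coset_act g x = y /\ coset_act g y = x).
Proof.
move=> /adj_levelP[s [u xy]] [gx gy].
pose p := (to_sd g)^-1.
have lev z : (val (coset_act g z)).1 = ((val z).1 + p.1)%R by [].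
have := lev x; have := lev y; rewrite gx gy.
by case: xy => -[-> ->] /=; lia.
Qed.

Lemma coset_act_trans x y : exists g, coset_act g x = y.
Proof.
exists (of_sd ((val y)^-1 * val x)).
by rewrite /coset_act of_sdK invgM invgK mulVKg to_vertexK.
Qed.

Lemma coset_minimal (S : coset_tree -> Prop) : subtree S ->
  (forall g x, S x -> S (coset_act g x)) -> forall x, S x.
Proof.
by move=> [[x Sx] _] S_act y; have [g <-] := coset_act_trans x y; apply: S_act.
Qed.

(** A vertex has a neighbour one level down, and several one level up: the lowest
letter of the window of level [s] is outside of the window of level [s + 1], so
multiplying by it changes the upper neighbour. *)
Lemma coset_not_valence2 (v : coset_tree) : ~ valence2 v.
Proof.
case=> [y [z [_ vyz]]].
set s := (val v).1; set u := (val v).2.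
pose c : (Y * bool)%type := (ord0, s - L%:R + 1, true)%R.
have sc: window s c.1 by rewrite /window /c /=; lia.
have s1c: window (s + 1)%R c.1 = false by rewrite /window /c /=; lia.
have rcu: reduced (c :: word u).
  have := word_reduced u; have := strip_vertex v; rewrite -/s -/u.
  case: (word u) => // a w su /= ->; rewrite andbT.
  by apply: contraFneq (strip_head su) => ->.
have vE w (rw : reduced w) :
    strip s w = word u -> v = to_vertex (s, FreeGroup rw).
  move=> sw; rewrite -[LHS](to_vertexK v); apply: val_inj; congr pair.
  by apply: val_inj; rewrite /= sw strip_vertex.
have vu : v = to_vertex (s, u).
  by rewrite -[LHS](to_vertexK v) -surjective_pairing.
pose up := to_vertex ((s + 1)%R, u).
pose up' := to_vertex ((s + 1)%R, FreeGroup rcu).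
pose down := to_vertex ((s - 1)%R, u).
have: [/\ up \in pred2 y z, up' \in pred2 y z & down \in pred2 y z].
  rewrite -!vyz; split; first by rewrite {1}vu; apply: adj_level.
    rewrite {1}(vE _ rcu) ?strip_vertex /= ?sc ?strip_vertex //.
    exact: adj_level.
  rewrite {1}vu -topredE /= parent_adj_sym.
  by have := adj_level (s - 1)%R u; rewrite GRing.subrK.
have up_up': up != up'.
  apply/eqP=> /(congr1 (fun x => size (word (val x).2))) /=.
  by rewrite s1c => e; have := size_strip (s + 1)%R (word u); rewrite e ltnn.
have down_up q : q.1 = (s + 1)%R -> down != to_vertex q.
  by move=> qs; apply/eqP=> /(congr1 (fun x => (val x).1)) /=; rewrite qs; lia.
have := down_up (_, FreeGroup rcu) erefl; have := down_up (_, u) erefl.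
rewrite -/up -/up' !inE => du du' [] /orP[]/eqP eu /orP[]/eqP eu' /orP[]/eqP ed.
all: by rewrite eu eu' ed ?eqxx in up_up' du du'.
Qed.

Lemma coset_irredundant (v : coset_tree) : valence2 v ->
  exists g, forall x, coset_act g x = x <-> x = v.
Proof. by move/coset_not_valence2. Qed.

Lemma coset_nontrivial : exists x y : coset_tree, x != y.
Proof.
exists (to_vertex (0%R, 1)), (to_vertex (1%R, 1)).
by apply/eqP=> /(congr1 (fun x => (val x).1)).
Qed.

Definition coset_splitting : splitting F :=
  @Splitting F coset_tree coset_act coset_act1 coset_actM coset_act_adj
    coset_act_noinv coset_minimal coset_irredundant coset_nontrivial.

(** The vertex [V a^s], which is the image of [V] under [a^-s]. *)
Definition axis s : coset_splitting := to_vertex (s, 1).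

Lemma strip_inv_nil s w : strip s (word_inv w) = [::] <-> strip s w = [::].
Proof.
split=> /strip_nil sw; apply/strip_nil; move: sw.
  by rewrite all_rev all_map.
by rewrite all_rev all_map.
Qed.

(** The stabilizer of [V a^s] is [V_s]. *)
Lemma axis_fixed s g :
  coset_act g (axis s) = axis s <->
  exists2 u, g = kernel_hom u & all (fun a => window s a.1) (word u).
Proof.
rewrite /axis /= coset_act_to_vertex; split=> [gs|[u -> su]].
  have q1 : (to_sd g).1 = 0%R.
    by have /= := congr1 (fun x => (val x).1) gs; lia.
  exists (to_sd g).2; first by rewrite -[LHS]to_sdK /of_sd q1 mul1g.
  apply/strip_nil/strip_inv_nil.
  have := congr1 (fun x => word (val x).2) gs; rewrite sd_mulE sd_invE q1 /=.
  by rewrite strip_shift; case: (strip _ _).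
rewrite to_sd_kernel sd_mulE sd_invE /=; apply: val_inj; congr pair.
  exact: GRing.subr0.
apply: val_inj; rewrite /= strip_shift.
by move/strip_nil/strip_inv_nil: su => ->.
Qed.

End CosetTree.

(** * The edge group *)

Section EdgeGroup.

Variables (n L : nat).
Hypothesis L_ge2 : 2 <= L.

(** The intersection of the windows of levels [0] and [1]: the indices [-j] with
[lo m <= j < L - 1], the one for [j = 0] being listed apart. *)
Definition edge_basis : seq ('I_n.+1 * int)%type :=
  (ord0, 0%R) :: [seq (m, Negz j) | m <- enum 'I_n.+1, j <- iota 0 (L - 2)].

Lemma size_edge_basis : size edge_basis = n.+1 * (L - 2) + 1.
Proof. by rewrite /= size_allpairs size_enum_ord size_iota addn1. Qed.

Lemma edge_basis_uniq : uniq edge_basis.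
Proof.
rewrite /= allpairs_uniq ?enum_uniq ?iota_uniq ?andbT //.
  by apply/allpairsPdep=> -[m [j [_ _]]].
by move=> [m i] [l j] _ _ [-> ->].
Qed.

Lemma mem_edge_basis y : (y \in edge_basis) = window L 0%R y && window L 1%R y.
Proof.
case: y => m i; rewrite inE /window /=; case: i => j.
  have ->: ((m, Posz j) \in [seq (m, Negz j) | m <- enum 'I_n.+1,
                                              j <- iota 0 (L - 2)]) = false.
    by apply/allpairsPdep=> -[? [? [_ _]]].
  by rewrite orbF xpair_eqE; case: (m == ord0) => /=; lia.
rewrite xpair_eqE andbF /=.
have ->: ((m, Negz j) \in [seq (m, Negz j) | m <- enum 'I_n.+1,
                                            j <- iota 0 (L - 2)]) = (j < L - 2).
  apply/allpairsPdep/idP=> [[l [i [_ + [_ ->]]]]|jL].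
    by rewrite mem_iota add0n.
  by exists m, j; rewrite mem_enum mem_iota.
by case: (m != ord0) => /=; lia.
Qed.

(** The edge group is the intersection of [V_0] and [V_1], and subgroups
generated by sets of letters intersect in the subgroup generated by the common
letters. *)
Lemma edge_group_free :
  free_of_rank (n.+1 * (L - 2) + 1) (fun g : freegroup 'I_n.+2 =>
    coset_act g (axis n L_ge2 0%R) = axis n L_ge2 0%R
    /\ coset_act g (axis n L_ge2 1%R) = axis n L_ge2 1%R).
Proof.
rewrite -size_edge_basis.
pose e (i : 'I_(size edge_basis)) := tnth (in_tuple edge_basis) i.
have e_inj : injective e by apply/tuple_uniqP/edge_basis_uniq.
exists (@kernel_hom n \o fg_map e_inj); split.
  move=> u v /(congr1 (@to_sd n)) /=; rewrite !to_sd_kernel => /(congr1 snd).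
  exact: fg_map_inj.
move=> g; split=> [[/axis_fixed[u -> u0] /axis_fixed[v]]|[w ->]].
  move=> /(congr1 (@to_sd n)); rewrite !to_sd_kernel => /(congr1 snd) /= <- u1.
  have [|w ->] := @fg_map_onto _ _ _ e_inj u; last by exists w.
  move=> a ua; suff /(tnthP (in_tuple edge_basis))[i ->]: a.1 \in edge_basis.
    by exists i.
  by rewrite mem_edge_basis (allP u0) ?(allP u1).
have: all (fun a => a.1 \in edge_basis) (word (fg_map e_inj w)).
  by apply/allP=> _ /mapP[a _ ->]; apply: mem_tnth.
move=> wE; split; apply/axis_fixed; exists (fg_map e_inj w) => //.
  by apply: sub_all wE => a; rewrite mem_edge_basis => /andP[].
by apply: sub_all wE => a; rewrite mem_edge_basis => /andP[].
Qed.

End EdgeGroup.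

(** * Reading words in the graph of the vertex group *)

Section Readings.

Variables (n L : nat).
Hypothesis L_ge2 : 2 <= L.

Notation letter := ('I_n.+2 * bool)%type.
Implicit Types (a f : letter) (s t : int) (u v w : seq letter).

(** This says that [a^s w a^-t] belongs to [V], so it holds when [w] labels a path
from [s] to [t] in the graph with vertices [0, ..., L] whose fundamental group
is [V].  The lemmas below provide the edges of that graph. *)
Definition reads s w t : Prop :=
  coset_act (word_eval (@fg_gen _) w) (axis n L_ge2 t) = axis n L_ge2 s.

Lemma reads_nil s : reads s [::] s.
Proof. exact: coset_act1. Qed.

Lemma reads_cat t s s' u v : reads s u t -> reads t v s' -> reads s (u ++ v) s'.
Proof. by move=> ut vs; rewrite /reads word_eval_cat coset_actM vs. Qed.

Lemma reads_inv s w t : reads s w t -> reads t (word_inv w) s.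
Proof.
by rewrite /reads => <-; rewrite word_eval_inv -coset_actM mulVg coset_act1.
Qed.

Lemma reads_gen x s t : t = (s + (sd_gen x).1)%R ->
  all (fun b => window L t b.1) (word (sd_gen x).2) -> reads s [:: (x, true)] t.
Proof.
move=> -> sx; rewrite /reads /= mulg1 (coset_act_to_vertex L_ge2).
rewrite /to_sd fg_hom_gen sd_mulE sd_invE /=; apply: val_inj; congr pair.
  exact: GRing.addrK.
apply: val_inj; rewrite /= strip_shift.
by move/strip_nil/strip_inv_nil: sx => ->.
Qed.

(** The generators [a] and [b], which go up by one in the graph. *)
Definition up (c : bool) : letter := (if c then lift ord0 ord0 else ord0, true).

Lemma reads_up c s : (0 <= s < L%:R)%R -> reads s [:: up c] (s + 1)%R.
Proof.
move=> sL; apply: reads_gen.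
  by case: c; rewrite /sd_gen ?liftK ?eqxx ?unlift_none.
case: c; rewrite /sd_gen ?liftK ?eqxx ?unlift_none //= /window /= andbT; lia.
Qed.

Lemma reads_down c s : (0 < s <= L%:R)%R ->
  reads s [:: letter_inv (up c)] (s - 1)%R.
Proof.
move=> sL; apply: (@reads_inv _ [:: up c]).
by have := @reads_up c (s - 1)%R; rewrite GRing.subrK; apply; lia.
Qed.

Lemma reads_letter a s : (0 < s < L%:R)%R ->
  exists2 t, reads s [:: a] t & (s - 1 <= t <= s + 1)%R.
Proof.
move=> sL; case: a => x b.
have [[c xc]|xs]: (exists c, x = (up c).1) \/ reads s [:: (x, true)] s.
- have [m ->|->] := unliftP ord0 x; last by left; exists false.
  have [->|m0] := eqVneq m ord0; first by left; exists true.
  right; apply: reads_gen; rewrite /sd_gen liftK (negPf m0) /= ?GRing.addr0 //.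
  by rewrite /window /= m0; lia.
- case: b; rewrite xc; last by exists (s - 1)%R; [apply: (@reads_down c)|]; lia.
  by exists (s + 1)%R; [apply: (@reads_up c)|]; lia.
exists s; last by lia.
by case: b => //; apply: (reads_inv xs).
Qed.

(** At a distance less than [h] from the vertex [h] all vertices are interior. *)
Lemma reads_half h v : (h%:R + h%:R <= L%:R :> int)%R -> size v <= h ->
  exists2 t, reads h%:R%R v t
  & (h%:R - (size v)%:R <= t <= h%:R + (size v)%:R)%R.
Proof.
move=> hL; elim/last_ind: v => [|v a IHv] vh.
  by exists h%:R%R; [apply: reads_nil | lia].
rewrite size_rcons in vh *; have [t vt tv] := IHv (ltnW vh).
have [|t' at' tt'] := @reads_letter a t; first by lia.
by exists t'; [rewrite -cats1; apply: reads_cat vt at' | lia].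
Qed.

(** The midpoint of the word is placed at the vertex [L / 2]. *)
Lemma reads_short w : ~~ odd L -> size w = L ->
  exists s t : nat, [/\ reads s%:R%R w t%:R%R, s <= L & t <= L].
Proof.
move=> L_even wL; pose h := L./2.
have hL : h + h = L by rewrite addnn even_halfK.
have [||s us sh] := @reads_half h (word_inv (take h w)); first by lia.
  by rewrite size_rev size_map size_take wL; case: ifP; lia.
have [||t vt th] := @reads_half h (drop h w); first by lia.
  by rewrite size_drop wL; lia.
have st: size (word_inv (take h w)) = h.
  by rewrite size_rev size_map size_takel // wL; lia.
rewrite st in sh; rewrite size_drop wL in th.
exists (absz s), (absz t); split; [|lia|lia].
have ->: ((absz s)%:R = s)%R by lia.
have ->: ((absz t)%:R = t)%R by lia.
rewrite -(cat_take_drop h w); apply: reads_cat vt.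
by rewrite -(word_invK (take h w)); apply: reads_inv us.
Qed.

Lemma reads_climb c s j : (0 <= s)%R -> (s + j%:R <= L%:R)%R ->
  reads s (nseq j (up c)) (s + j%:R)%R.
Proof.
elim: j s => [|j IHj] s s0 sj; first by rewrite GRing.addr0; apply: reads_nil.
rewrite (_ : s + j.+1%:R = s + 1 + j%:R)%R; last by lia.
apply: (@reads_cat (s + 1)%R _ _ [:: _]); first by apply: reads_up; lia.
by apply: IHj; lia.
Qed.

(** With [c] and [d] the two letters going up, the vertex [j] is reached from [0]
by [c d^-1 c^j] and by [c c d^-1 c^-1 d^j].  The last letters are [c] and [d]
when [j > 0], and [d^-1] and [c^-1] when [j = 0]: a given letter [f] cancels
with at most one of the two. *)
Lemma reads_prefix c j f : j <= L -> exists2 p,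
  reads 0%R (up c :: p) j%:R%R & reduced (up c :: rcons p f).
Proof.
move=> jL; set d := ~~ c.
have cd: up c != up d by rewrite /d; case: (c).
have up_inv b b' : up b != letter_inv (up b') by rewrite xpair_eqE andbF.
have climb a b : reduced (a :: rcons (nseq j (up b)) f) =
    if j == 0 then f != letter_inv a
    else (up b != letter_inv a) && (f != letter_inv (up b)).
  case: (j) => [|i]; first by rewrite /reduced /= andbT.
  rewrite /reduced /=; congr (_ && _).
  by elim: i => [|i IHi] /=; rewrite ?andbT // IHi up_inv.
have [red1|] := boolP (reduced (letter_inv (up d) :: rcons (nseq j (up c)) f)).
  exists (letter_inv (up d) :: nseq j (up c)); last first.
    apply/andP; split=> //.
    by rewrite (inj_eq (can_inj (@letter_invK _))) eq_sym.
  apply: (@reads_cat 1%R _ _ [:: _]); first by apply: reads_up; lia.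
  apply: (@reads_cat 0%R _ _ [:: _]); first by apply: reads_down; lia.
  by rewrite -[j%:R%R]GRing.add0r; apply: reads_climb; lia.
rewrite climb => red1.
exists [:: up c, letter_inv (up d), letter_inv (up c) & nseq j (up d)].
  apply: (@reads_cat 1%R _ _ [:: _]); first by apply: reads_up; lia.
  apply: (@reads_cat 2%R _ _ [:: _]); first by apply: (@reads_up c 1%R); lia.
  apply: (@reads_cat 1%R _ _ [:: _]); first by apply: (@reads_down d 2%R); lia.
  apply: (@reads_cat 0%R _ _ [:: _]); first by apply: reads_down; lia.
  by rewrite -[j%:R%R]GRing.add0r; apply: reads_climb; lia.
have: reduced (letter_inv (up c) :: rcons (nseq j (up d)) f).
  rewrite climb; move: red1; case: (j == 0).
    by rewrite !letter_invK negbK => /eqP->; rewrite eq_sym.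
  rewrite !letter_invK cd (eq_sym (up d)) cd /= negbK => /eqP->.
  by rewrite (inj_eq (can_inj (@letter_invK _))).
rewrite /reduced /= => ->; rewrite !andbT up_inv /=.
rewrite !(inj_eq (can_inj (@letter_invK _))) (eq_sym (up d)) cd /=.
exact: up_inv.
Qed.

(** Reducedness is a condition on consecutive letters, so reduced words can be
glued along a common letter. *)
Lemma reduced_overlap u a v :
  reduced (rcons u a) -> reduced (a :: v) -> reduced (u ++ a :: v).
Proof.
case: u => // b u; rewrite /reduced /= rcons_path cat_path /=.
by case/andP=> -> ->.
Qed.

Lemma word_inv_rcons w a : word_inv (rcons w a) = letter_inv a :: word_inv w.
Proof. by rewrite /word_inv map_rcons rev_rcons. Qed.

Lemma word_inv_cons a w : word_inv (a :: w) = rcons (word_inv w) (letter_inv a).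
Proof. by rewrite /word_inv /= rev_cons. Qed.

(** Words of the form [a v b^-1] can be concatenated, and are cyclically reduced
as soon as they are reduced. *)
Definition bracket v := up false :: rcons v (letter_inv (up true)).

Definition bracket_loop v : Prop :=
  reduced (bracket v) /\ reads 0%R (bracket v) 0%R.

(** A path labelled by [w] is completed by a path from [0] to its origin, starting
with [a], and by the inverse of a path from [0] to its end, starting with [b]. *)
Lemma bracket_infix w : ~~ odd L -> reduced w -> size w = L ->
  exists2 v, bracket_loop v & infix w v.
Proof.
move=> L_even rw wL; have [s [t [wst sL tL]]] := reads_short L_even wL.
have [f [w1 ew1]]: exists f w1, w = f :: w1.
  by case: (w) wL => [L0|f w1 _]; [move: L_ge2; rewrite -L0 | exists f, w1].
have [w2 [l ew2]]: exists w2 l, w = rcons w2 l.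
  case: (lastP w) wL => [L0|w2 l _]; last by exists w2, l.
  by move: L_ge2; rewrite -L0.
have [p pread pred] := reads_prefix false f sL.
have [q qread qred] := reads_prefix true (letter_inv l) tL.
exists (p ++ w ++ word_inv q); last by apply/infixP; exists p, (word_inv q).
rewrite /bracket_loop.
have -> : bracket (p ++ w ++ word_inv q)
          = (up false :: p) ++ w ++ word_inv (up true :: q).
  by rewrite /bracket word_inv_cons -!rcons_cat.
split; last by apply: reads_cat pread (reads_cat wst (reads_inv qread)).
rewrite ew1; apply: reduced_overlap => //; rewrite -cat_cons -ew1 ew2 cat_rcons.
apply: reduced_overlap; first by rewrite -ew2.
by rewrite -[l]letter_invK -word_inv_rcons; apply: word_inv_reduced.
Qed.

Lemma bracket_all (ws : seq (seq letter)) : ~~ odd L ->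
  (forall w, w \in ws -> reduced w /\ size w = L) ->
  exists2 v, bracket_loop v & forall w, w \in ws -> infix w v.
Proof.
move=> L_even; elim: ws => [|w ws IHws] wsP.
  exists [::] => //; split; first by [].
  apply: (@reads_cat 1%R _ _ [:: _]); first by apply: reads_up; lia.
  by apply: (@reads_down true 1%R); lia.
have [rw wL] := wsP w (mem_head _ _).
have [v1 [red1 read1] wv1] := bracket_infix L_even rw wL.
have [|v2 [red2 read2] wsv2] := IHws.
  by move=> w' w'ws; apply: wsP; rewrite inE w'ws orbT.
exists (rcons v1 (letter_inv (up true)) ++ up false :: v2).
  have e: bracket (rcons v1 (letter_inv (up true)) ++ up false :: v2)
      = bracket v1 ++ bracket v2 by rewrite /bracket rcons_cat.
  split; rewrite e; last exact: reads_cat read1 read2.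
  apply: reduced_overlap red2.
  rewrite /bracket rcons_cons /reduced /= rcons_path.
  by rewrite (red1 : is_true (path _ _ _)) last_rcons.
move=> w' /predU1P[->|/wsv2 w'v2].
  by rewrite -cats1 -catA; apply: infix_catr.
by rewrite -cat_rcons; apply: infix_catl.
Qed.

End Readings.

(** * The splitting *)

Theorem proposition4p3 (k L : nat) (hk : 2 <= k) (hL : 2 <= L)
    (L_even : ~~ odd L) :
  exists (T : splitting (freegroup 'I_k)) (A : freegroup 'I_k -> Prop)
      (h : freegroup 'I_k),
    [/\ is_edge_group T A,
        free_of_rank ((k - 1) * (L - 2) + 1) A,
        relative_to T h,
        cyclically_reduced (word h)
      & forall w : seq ('I_k * bool),
          reduced w -> size w = L -> infix w (word h)].
Proof.
case: k hk => [//|[//|n]] _; rewrite subn1 /=.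
pose ws :=
  [seq val w | w <- enum {: L.-tuple ('I_n.+2 * bool)} & reduced (val w)].
have [|v [red_v read_v] wsv] := @bracket_all n L hL ws L_even.
  move=> u /mapP[w]; rewrite mem_filter => /andP[rw _] ->.
  by rewrite size_tuple.
exists (coset_splitting n hL).
eexists; exists (FreeGroup red_v); split.
- exists (axis n hL 0%R), (axis n hL 1%R); split; first exact: adj_level.
  by move=> g; apply: iff_refl.
- exact: edge_group_free.
- by exists (axis n hL 0%R); rewrite [FreeGroup _]freegroupE.
- by rewrite /cyclically_reduced red_v /= last_rcons.
move=> w rw wL.
have ->: word (FreeGroup red_v)
    = [:: up n false] ++ v ++ [:: letter_inv (up n true)] by rewrite cats1.
apply: infix_catl; apply: infix_catr; apply: wsv.
apply/mapP; exists (tcast wL (in_tuple w)); last by rewrite /= val_tcast.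
by rewrite mem_filter /= val_tcast rw mem_enum.
Qed.
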